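(* Let $G$ be a finite non-solvable group and let $x\in G$ be such that $nil_G(x)$ generates a maximal subgroup of $G$. Then $|nil_G(x)|\neq p^n$ for every prime $p$ and every $n\in\{1,2\}$.
   Context: For a group $G$ and $x\in G$, the nilpotentizer of $x$ in $G$ is the subset $nil_G(x)=\{y\in G \mid \langle x,y\rangle \text{ is nilpotent}\}$ (in general not a subgroup). All groups are finite. *)

(* Defs.v *)
From mathcomp Require Import all_boot all_fingroup all_solvable.

Set Implicit Arguments.
Unset Strict Implicit.
Unset Printing Implicit Defensive.

Local Open Scope group_scope.

Definition nilpotentizer (gT : finGroupType) (G : {set gT}) (x : gT)
    : {set gT} :=
  [set y in G | nilpotent <<[set x; y]>>].

(* Main.v *)
(** If [nil_G(x)] has order [p] or [p^2], then [x] is a [p]-element, because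
    [nil_G(x)] is a union of cosets of [<x>].  A Sylow [p]-subgroup containing
    [x] lies in [nil_G(x)], so it is abelian; this forces [nil_G(x) = C_G(x)],
    which is then an abelian maximal subgroup of prime power order.  A group [G]
    with such a subgroup [M] is solvable: if [M] is not normal, it is a
    self-normalizing Sylow subgroup, Burnside's theorem gives a normal
    complement [K], some Sylow subgroup [Q] of [K] is normalized by [M], and
    maximality yields [G = Q M]. *)

Require Import Defs.
From mathcomp Require Import all_boot all_fingroup all_solvable.
From mathcomp Require Import ssralg.

Set Implicit Arguments.
Unset Strict Implicit.
Unset Printing Implicit Defensive.

Local Open Scope group_scope.

Section BurnsideTransfer.

Variables (gT : finGroupType) (p : nat) (G P : {group gT}).
Hypotheses (sylP : p.-Sylow(G) P) (cNP : 'N_G(P) \subset 'C(P)).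

Let abelP : abelian P.
Proof.
by apply: subset_trans cNP; rewrite subsetI (pHall_sub sylP) normG.
Qed.

(** Conjugacy in [G] between elements of the abelian [P] is realized inside ['N_G(P)], which
    centralizes [P]. *)
Lemma central_Sylow_fusion a x :
  a \in P -> x \in G -> a ^ x \in P -> a ^ x = a.
Proof.
move=> Pa Gx Pax.
have sPG := pHall_sub sylP.
have sPC: P \subset 'C_G[a ^ x] by rewrite subsetI sPG sub_cent1 (subsetP abelP).
have sPxC: P :^ x \subset 'C_G[a ^ x].
  rewrite cent1J -{1}(conjGid Gx) -conjIg conjSg.
  by rewrite subsetI sPG sub_cent1 (subsetP abelP).
(* P and P :^ x are both Sylow in the centralizer of a ^ x, so they are conjugate
   there, and the conjugation can be absorbed into x. *)
have sylP_C := pHall_subl sPC (subsetIl _ _) sylP.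
have sylPx_C: p.-Sylow('C_G[a ^ x]) (P :^ x)%G.
  by apply: pHall_subl (subsetIl _ _) _; rewrite //= pHallJ.
have [c /setIP[Gc /cent1P cac] defP] := Sylow_trans sylPx_C sylP_C.
have Nxc: x * c \in 'N_G(P).
  by rewrite inE groupM //=; apply/normP; rewrite conjsgM -defP.
have: a ^ (x * c) = a.
  by apply/conjg_fixP/commgP/esym/(centP (subsetP cNP _ Nxc)).
by have /commgP/conjg_fixP cax := esym cac; rewrite conjgM cax.
Qed.

(** The complement is the kernel of the transfer from [G] to [P], which is injective on [P]. *)
Theorem Burnside_normal_complement : exists K : {group gT}, K ><| P = G.
Proof.
have sPG := pHall_sub sylP.
have defA: idm P @* P = P by rewrite morphim_idm.
have abelA: abelian (idm P @* P) by rewrite defA.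
pose V := transfer_morphism G abelA.
(* Absence of fusion in P reduces every term of the cycle expansion to a power
   of g, so the transfer on P is the (invertible) power map by |G : P|. *)
have V_P g: g \in P -> V g = (FiniteModule.fmod abelA g *+ #|G : P|)%R.
  move=> Pg; have Gg := subsetP sPG g Pg.
  have [X trX] : {X : {set gT} | is_transversal X (rcosets P G :* <[g]>) G}.
    by exists (transversal (rcosets P G :* <[g]>) G);
       apply: transversalP (rcosets_cycle_partition sPG Gg).
  rewrite /V /= (transfer_cycle_expansion sPG abelA Gg trX).
  rewrite -(sum_index_rcosets_cycle sPG Gg trX) -GRing.sumrMnr.
  apply: eq_bigr => x Xx; have Gx := subsetP (transversal_sub trX) x Xx.
  rewrite central_Sylow_fusion ?groupX ?groupV //=.
    by rewrite /restrm /= FiniteModule.fmodX //= defA.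
  by rewrite conjgE invgK mulgA -mem_rcoset mulg_exp_card_rcosets.
have coP: coprime #|P| #|G : P|.
  by have /and3P[_ pP] := sylP; apply: pnat_coprime.
have injV: {in P, forall g, V g = 0%R -> g = 1}.
  move=> g Pg; rewrite V_P // -FiniteModule.fmodX /= ?defA // => Vg0.
  rewrite -(expgK coP Pg) /=.
  rewrite -(FiniteModule.fmodK abelA (_ : g ^+ #|G : P| \in _)).
    by rewrite Vg0 expg1n.
  by rewrite groupX /= ?defA.
have tiKP: 'ker V :&: P = 1.
  apply/trivgP/subsetP=> g /setIP[/morphpreP[_ /set1P Vg1] Pg].
  by apply/set1P/injV.
exists ('ker V)%G; rewrite sdprodE //; last exact: subset_trans sPG (ker_norm V).
apply/eqP; rewrite eqEcard mul_subG ?subsetIl //= TI_cardMg //.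
(* The transfer takes values in a module of order [#|P|], so its kernel has index at most [#|P|]. *)
rewrite -(Lagrange (subsetIl _ _ : 'ker V \subset G)) leq_mul2l.
rewrite -card_quotient ?ker_norm // (card_isog (first_isog V)) orbC.
rewrite (leq_trans (max_card _)) //.
rewrite -(card_imset _ (@FiniteModule.fmod_inj _ _ abelA)) subset_leq_card //.
apply/subsetP=> _ /imsetP[u _ ->].
by have:= FiniteModule.fmodP u; rewrite /= defA.
Qed.

End BurnsideTransfer.

Lemma normal_complement_invariant_pgroup (gT : finGroupType) (p q : nat)
    (G M K : {group gT}) :
    p.-Sylow(G) M -> K <| G -> K :&: M = 1 -> prime q -> q %| #|K| ->
  exists Q : {group gT},
    [/\ Q \subset K, q.-group Q, Q :!=: 1 & M \subset 'N(Q)].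
Proof.
(* By the Frattini argument the normalizer of a Sylow q-subgroup of K contains
   a conjugate of M. *)
move=> sylM nsKG tiKM q_pr qK; have [Q sylQ] := Sylow_exists q K.
have [sQK qQ _] := and3P sylQ.
have p'K: p^'.-group K.
  have /card_Hall := Sylow_setI_normal nsKG sylM.
  by rewrite /= tiKM cards1 => /esym/eqP; rewrite partn_eq1.
have [S sylS] := Sylow_exists p 'N_G(Q).
have sSG := subset_trans (pHall_sub sylS) (subsetIl _ _).
have [x Gx sSMx] := Sylow_subJ sylM sSG (pHall_pgroup sylS).
have defS: S :=: M :^ x.
  apply/eqP; rewrite eqEcard sSMx cardJg (card_Hall sylS) (card_Hall sylM).
  (* By Frattini [G = K 'N_G(Q)]; as [K] is a [p^']-group, the whole [p]-part of [#|G|] divides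
     [#|'N_G(Q)|]. *)
  have: #|G| %| #|K| * #|'N_G(Q)|.
    by rewrite mul_cardG (Frattini_arg nsKG sylQ) dvdn_mulr.
  move/(partn_dvd p); rewrite muln_gt0 !cardG_gt0 partnM //.
  by rewrite (part_p'nat p'K) mul1n => /(_ isT)/dvdn_leq->.
exists (Q :^ x^-1)%G; split.
- by rewrite sub_conjgV (normsP (normal_norm nsKG) x Gx).
- by rewrite /= pgroupJ.
- rewrite -cardG_gt1 cardJg (card_Hall sylQ) p_part_gt1.
  by rewrite mem_primes q_pr cardG_gt0.
by rewrite normJ -sub_conjg -defS (subset_trans (pHall_sub sylS)) ?subsetIr.
Qed.

Lemma solvable_abelian_maximal_pgroup (gT : finGroupType) (p : nat)
    (G M : {group gT}) :
  maximal M G -> p.-group M -> abelian M -> solvable G.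
Proof.
case/maxgroupP=> /[dup] prMG /andP[sMG not_sGM] maxM pM abelM.
have maxE (H : {group gT}) : M \subset H -> H \subset G -> H :=: M \/ H :=: G.
  move=> sMH sHG; have [->|neqHG] := eqVneq (H : {set _}) G; first by right.
  by left; apply: maxM; rewrite ?properEneq ?neqHG.
have [nMG|not_nMG] := boolP (G \subset 'N(M)).
  (* By maximality any [g] outside the normal subgroup [M] gives [G = M <[g]>], so [G / M] is
     cyclic. *)
  have [g Gg M'g] := subsetPn not_sGM.
  have sMgG: M <*> <[g]> \subset G by rewrite join_subG sMG cycle_subG.
  have [defM|<-] := maxE (M <*> <[g]>)%G (joing_subl _ _) sMgG.
    by rewrite -cycle_subG -defM joing_subr in M'g.
  have nMg: <[g]> \subset 'N(M) by rewrite cycle_subG (subsetP nMG).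
  rewrite (series_sol (_ : M <| _)) ?normalYl //.
  rewrite abelian_sol //= quotientYidl //.
  by rewrite abelian_sol // quotient_abelian ?cycle_abelian.
have NM: 'N_G(M) = M.
  have [] // := maxE 'N_G(M)%G; rewrite ?subsetI ?sMG ?normG ?subsetIl //.
  by move/setIidPl; rewrite (negPf not_nMG).
have sylM: p.-Sylow(G) M.
  have [S sylS sMS] := Sylow_superset sMG pM.
  suffices <- : S :=: M by [].
  (* A proper subgroup of the [p]-group [S] would be proper in its normalizer in [S]. *)
  apply: nilpotent_sub_norm (pgroup_nil (pHall_pgroup sylS)) sMS _.
  by rewrite -{2}NM setSI ?(pHall_sub sylS).
have [|K defG] := Burnside_normal_complement sylM; first by rewrite NM.
have [nsKG _ mulKM nKM tiKM] := sdprod_context defG.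
have [K1|ntK] := eqVneq (K : {set gT}) 1.
  by rewrite -mulKM K1 mul1g subxx in not_sGM.
have [q q_pr qK] : exists2 q, prime q & q %| #|K|.
  by exists (pdiv #|K|); rewrite ?pdiv_dvd ?pdiv_prime ?cardG_gt1.
have [Q [sQK qQ ntQ nQM]] :=
  normal_complement_invariant_pgroup sylM nsKG tiKM q_pr qK.
have sQMG: Q <*> M \subset G.
  by rewrite join_subG sMG (subset_trans sQK) ?normal_sub.
(* If [Q <*> M = M], then [Q] lies in [K :&: M = 1]. *)
have [defM|<-] := maxE (Q <*> M)%G (joing_subr _ _) sQMG.
  case/eqP: ntQ; apply/trivgP; rewrite -tiKM subsetI sQK.
  by rewrite -defM joing_subl.
rewrite (series_sol (_ : Q <| _)) ?normalYl //.
rewrite (pgroup_sol qQ) /= quotientYidl //.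
by rewrite abelian_sol // quotient_abelian.
Qed.

Section Nilpotentizer.

Variables (gT : finGroupType) (G : {group gT}) (x : gT).
Hypothesis Gx : x \in G.

(** Since [x] and [y * x] generate the same group as [x] and [y], right multiplication by [<[x]>]
    preserves the set, with orbits of size [#[x]]. *)
Lemma order_dvd_nilpotentizer : #[x] %| #|nilpotentizer G x|.
Proof.
have actsN: [acts <[x]>, on nilpotentizer G x | 'R].
  rewrite cycle_subG; apply/astabsP=> y; rewrite /= !inE groupMr //.
  congr (_ && nilpotent _); apply/eqP.
  rewrite eqEsubset !gen_subG !subUset !sub1set /=.
  have gx z : x \in <<[set x; z]>> by rewrite mem_gen ?set21.
  have gz z : z \in <<[set x; z]>> by rewrite mem_gen ?set22.
  by rewrite !gx groupM //= -(groupMr y (gx _)) gz.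
rewrite (@card_uniform_partition _ #[x] _ _ _ (orbit_partition actsN)) //.
  exact: dvdn_mull.
by move=> _ /imsetP[y _ ->]; rewrite orbitR card_lcoset.
Qed.

(** A nilpotent [H = <<[set x; y]>>] is the direct product of ['O_p(H)] and ['O_p^'(H)]. The first
    factor contains [x] and is abelian, lying in a conjugate of [P]; so [x] centralizes both. *)
Lemma nilpotentizer_abelian_Sylow (p : nat) (P : {group gT}) :
  p.-Sylow(G) P -> abelian P -> x \in P -> nilpotentizer G x = 'C_G[x].
Proof.
move=> sylP abelP Px; apply/setP=> y; rewrite in_setI [LHS]inE.
have [Gy|//] /= := boolP (y \in G).
apply/idP/cent1P => [nilH | cxy]; last first.
  apply: abelian_nil; rewrite abelian_gen /abelian subUset !sub1set.
  by apply/andP; split; apply/centP=> z /set2P[]->.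
pose H := <<[set x; y]>>%G.
have [Hx Hy] : x \in H /\ y \in H by rewrite !mem_gen ?set21 ?set22.
have sHG : H \subset G by rewrite gen_subG subUset !sub1set Gx.
have sOG := subset_trans (pcore_sub p H) sHG.
have [g _ sOPg] := Sylow_subJ sylP sOG (pcore_pgroup p H).
have abelO: abelian 'O_p(H) by apply: abelianS sOPg _; rewrite abelianJ.
have Ox: x \in 'O_p(H).
  rewrite (mem_normal_Hall (nilpotent_pcore_Hall p nilH)) ?pcore_normal //.
  exact: mem_p_elt (pHall_pgroup sylP) Px.
have [_ defH cOO' _] := dprodP (nilpotent_pcoreC p nilH).
have: H \subset 'C[x].
  rewrite -[gval H]defH mul_subG ?sub_cent1 ?(subsetP abelO) //.
  by rewrite (subsetP _ _ Ox) // centsC.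
by move/subsetP/(_ y Hy)/cent1P.
Qed.

End Nilpotentizer.

Local Close Scope group_scope.

Theorem theorem1p3 (gT : finGroupType) (G : {group gT}) (x : gT)
    (nsolG : ~~ solvable G) (Gx : x \in G)
    (maxN : maximal <<nilpotentizer G x>>%g G)
    (p n : nat) (pr_p : prime p) (n12 : n \in [:: 1; 2]) :
  #|nilpotentizer G x| <> (p ^ n)%N.
Proof.
move=> oN; case/negP: nsolG.
have le_n2: n <= 2 by case/or3P: n12 => // /eqP->.
have pN: p.-nat #|nilpotentizer G x| by rewrite oN pnatX pnat_id.
have p_x: p.-group%g <[x]>%g := pnat_dvd (order_dvd_nilpotentizer Gx) pN.
have sxG: (<[x]> \subset G)%g by rewrite cycle_subG.
have [P sylP] := Sylow_superset sxG p_x; rewrite cycle_subG => Px.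
have [sPG pP _] := and3P sylP.
have sPN: P \subset nilpotentizer G x.
  apply/subsetP=> y Py; rewrite inE (subsetP sPG) //=.
  apply: pgroup_nil (pgroupS _ pP).
  by rewrite gen_subG subUset !sub1set Px.
have abelP: abelian P.
  apply: (p2group_abelian pP); apply: leq_trans le_n2.
  rewrite -(leq_exp2l _ _ (prime_gt1 pr_p)) -p_part part_pnat_id // -oN.
  exact: subset_leq_card.
have defN := nilpotentizer_abelian_Sylow Gx sylP abelP Px.
(* The set is now the subgroup ['C_G[x]], so it equals the maximal subgroup it generates. *)
rewrite defN genGid in maxN; rewrite defN in oN pN.
apply: (solvable_abelian_maximal_pgroup maxN pN).
by apply: (p2group_abelian pN); rewrite oN pfactorK.
Qed.
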